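(* Let $n\geq 2$ and let $a=(a_1,\dots,a_n)$ be positive integers with $a_1\geq a_2\geq\dots\geq a_n$ and $\prod_{i=1}^n a_i=\sum_{i=1}^n a_i$. Then for every $1\leq k\leq n$, $$\prod_{i=1}^k a_i\leq \sum_{i=1}^k a_i+n-k.$$ Moreover, if $k_\star$ denotes the greatest index $k$ with $a_k>1$, then this inequality holds with equality for $k\geq k_\star$ and holds strictly for $k<k_\star$. *)

(* Defs.v *)
From mathcomp Require Import all_boot.

Set Implicit Arguments.
Unset Strict Implicit.
Unset Printing Implicit Defensive.

(* A tuple (a_1, ..., a_n) is given by a function [a : nat -> nat] of which only
   the values at the indices 1, ..., n are used. *)

(* The sum and product of the first [k] entries a_1, ..., a_k. *)
Definition psum (a : nat -> nat) (k : nat) : nat := \sum_(1 <= i < k.+1) a i.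
Definition pprod (a : nat -> nat) (k : nat) : nat := \prod_(1 <= i < k.+1) a i.

Definition greatest_index_gt1 (n : nat) (a : nat -> nat) (m : nat) : Prop :=
  [/\ 1 <= m <= n, 1 < a m & forall i, 1 <= i <= n -> 1 < a i -> i <= m].

(* Main.v *)
(** The defect [f k = psum a k + (n - k) - pprod a k] satisfies
    [f k - f (k+1) = (pprod a k - 1) * (a (k+1) - 1) >= 0] and [f n = 0]. *)
Require Import Defs.
From mathcomp Require Import all_boot zify.

(** Since the defect drops by a product of nonnegative factors at each step and vanishes at [n], it
    is nonnegative throughout ([pprod_le_psum]). Past the last entry exceeding 1 all entries are 1,
    so the defect stays at its final value 0 ([pprod_tail1], [psum_tail1]). Before it, monotonicity
    ([noninc_leq]) makes both factors positive, so the defect at [k] strictly exceeds the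
    nonnegative defect at [k.+1]. *)

Lemma pprodS a k : pprod a k.+1 = pprod a k * a k.+1.
Proof. by rewrite /pprod big_nat_recr. Qed.

Lemma psumS a k : psum a k.+1 = psum a k + a k.+1.
Proof. by rewrite /psum big_nat_recr. Qed.

Lemma pprod_gt0 n a k : (forall i, 1 <= i <= n -> 0 < a i) ->
  k <= n -> 0 < pprod a k.
Proof.
move=> a_pos; elim: k => [|k IHk] le_kn; first by rewrite /pprod big_geq.
by rewrite pprodS muln_gt0 IHk ?a_pos // ltnW.
Qed.

Lemma pprod_tail1 n a k : k <= n -> (forall i, k < i <= n -> a i = 1) ->
  pprod a n = pprod a k.
Proof.
move=> le_kn a1; rewrite /pprod (@big_cat_nat _ _ _ k.+1) //=.
rewrite [X in _ * X](_ : _ = 1) ?muln1 // big_nat.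
by apply: big1 => i; rewrite ltnS => /a1.
Qed.

Lemma psum_tail1 n a k : k <= n -> (forall i, k < i <= n -> a i = 1) ->
  psum a n = psum a k + (n - k).
Proof.
move=> le_kn a1; rewrite /psum (@big_cat_nat _ _ _ k.+1) //=; congr (_ + _).
transitivity (\sum_(k.+1 <= i < n.+1) 1); last by rewrite sum_nat_const_nat muln1.
by apply: eq_big_nat => i; rewrite ltnS => /a1.
Qed.

Lemma noninc_leq n a i j : (forall i, 1 <= i < n -> a i.+1 <= a i) ->
  0 < i -> i <= j -> j <= n -> a j <= a i.
Proof.
move=> a_noninc i_gt0; elim: j => [|j IHj] le_ij le_jn; first by lia.
have [->//|ne_ij] := eqVneq i j.+1.
by apply: leq_trans (a_noninc j _) (IHj _ _); lia.
Qed.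

Lemma pprod_le_psum n a k : (forall i, 1 <= i <= n -> 0 < a i) ->
  pprod a n = psum a n -> k <= n -> pprod a k <= psum a k + (n - k).
Proof.
(* Writing [k] as [n - (n - k)] turns descent from [n] into induction on the distance to [n]. *)
move=> a_pos eq_n le_kn; rewrite -(subKn le_kn).
elim: (n - k) (leq_subr k n) => [|j IHj] le_jn; first by rewrite subn0 eq_n leq_addr.
have := IHj (ltnW le_jn); have -> : n - j = (n - j.+1).+1 by lia.
have := pprod_gt0 n a (n - j.+1) a_pos (leq_subr _ _).
have : 0 < a (n - j.+1).+1 by apply: a_pos; lia.
(* With P the shorter product and x the next entry, both at least 1, (P - 1)(x - 1) >= 0 gives P + x
   <= 1 + P x. *)
by rewrite pprodS psumS; nia.
Qed.

Theorem theorem3p1 (n : nat) (a : nat -> nat)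
    (n_ge2 : 2 <= n)
    (a_pos : forall i, 1 <= i <= n -> 0 < a i)
    (a_noninc : forall i, 1 <= i < n -> a i.+1 <= a i)
    (a_prod_sum : pprod a n = psum a n) :
  [/\ forall k, 1 <= k <= n -> pprod a k <= psum a k + (n - k),
      exists kstar, greatest_index_gt1 n a kstar
    & forall kstar, greatest_index_gt1 n a kstar ->
        (forall k, 1 <= k <= n -> kstar <= k ->
           pprod a k = psum a k + (n - k)) /\
        (forall k, 1 <= k <= n -> k < kstar ->
           pprod a k < psum a k + (n - k))].
Proof.
have tail1 m : (forall i, 1 <= i <= n -> 1 < a i -> i <= m) ->
    forall i, m < i <= n -> a i = 1.
  move=> max_m i /andP[lt_mi le_in].
  have i_rng : 1 <= i <= n by lia.
  by have := max_m i i_rng; have := a_pos i i_rng; lia.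
split=> [k /andP[_ le_kn]||m [m_rng am_gt1 max_m]].
- exact: pprod_le_psum.
- pose P i := (1 <= i <= n) && (1 < a i).
  have [/hasP[i _ Pi]|/hasPn noP] := boolP (has P (iota 0 n.+1)).
    have [|i0|m /andP[m_rng am_gt1] max_m] := @ex_maxnP P n; first by exists i.
      by case/andP=> /andP[].
    by exists m; split=> // j j_rng aj_gt1; apply: max_m; rewrite /P j_rng.
  have all1 i : 0 < i <= n -> a i = 1.
    apply: (tail1 0) => j j_rng aj_gt1; have := noP j.
    by rewrite mem_iota /P j_rng aj_gt1; lia.
  (* If every entry were 1, the product would be 1 and the sum [n], contradicting [n_ge2]. *)
  move: a_prod_sum; rewrite (pprod_tail1 _ _ _ (leq0n n) all1) (psum_tail1 _ _ _ (leq0n n) all1).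
  by rewrite /pprod /psum !big_geq //; lia.
split=> k /andP[k_gt0 le_kn] k_m.
  have a1 i : k < i <= n -> a i = 1 by move=> i_rng; apply: (tail1 m max_m); lia.
  by rewrite -(pprod_tail1 _ _ _ le_kn a1) -(psum_tail1 _ _ _ le_kn a1).
have := pprod_le_psum n a k.+1 a_pos a_prod_sum.
have : a m <= a k.+1 by apply: (noninc_leq n) => //; lia.
have : a k.+1 <= a k by apply: a_noninc; lia.
(* Strict form of the same inequality: both factors of the drop are now positive. *)
have : 1 < pprod a k -> 1 < a k.+1 ->
    pprod a k + a k.+1 < 1 + pprod a k * a k.+1 by nia.
(* As [k] is positive, the product contains [a k], so it exceeds 1 because
   [a k >= a k.+1 >= a m > 1]. *)
have : a k <= pprod a k.
  case: k k_gt0 le_kn {k_m} => // k _ le_kn.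
  by rewrite pprodS leq_pmull // (pprod_gt0 n) // ltnW.
by rewrite pprodS psumS; lia.
Qed.
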